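(* Let $n\ge 1$ be an integer. For every integer $0\le r\le n-1$, $$\mathbb E M_{n,r}\le \inf_{0\le\varepsilon\le1}\left\{\varphi^{+}_{n,r}(\varepsilon)+\psi^{+}_{n,r}(\varepsilon)\right\},$$ where $$\varphi^{+}_{n,r}(\varepsilon)=\frac{c(r)\,\nu(\varepsilon)}{n},\qquad \psi^{+}_{n,r}(\varepsilon)=2^{1+r}\binom{n}{r}\int_{0}^{\varepsilon}\nu\left(\frac u2\right)u^r\left(1-\frac u2\right)^{n-r}\mathrm du .$$ Further, $$\mathbb E M_{n,n}\le \inf_{0\le\varepsilon\le1}\left\{p_\star^{\,n+1}\,\nu(\varepsilon)+\varepsilon^n\right\},$$ where $p_\star=\max\{p_a:a\in\mathcal A\}\in(0,1]$.
   Context: $\mathcal A$ is an at most countable set and $P=\{p_a:a\in\mathcal A\}$ is a probability distribution on $\mathcal A$ ($p_a\in[0,1]$, $\sum_{a}p_a=1$). $X_1,\dots,X_n$ are i.i.d. $\mathcal A$-valued random variables with distribution $P$; $\xi_n(a)=\sum_{i=1}^n\mathbf 1\{X_i=a\}$. For $0\le r\le n$, the occupancy probability is $M_{n,r}=\sum_{a\in\mathcal A}p_a\mathbf 1\{\xi_n(a)=r\}$. The counting function of $P$ is $\nu(\varepsilon)=|\{a\in\mathcal A:p_a\ge\varepsilon\}|$ for $0\le\varepsilon\le 1$ (possibly $+\infty$ at $\varepsilon=0$). The constant $c(r)$ is $c(0)=e^{-1}$ and $c(r)=e(1+r)/\sqrt{\pi}$ for $r\ge 1$. *)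

(* Defs.v *)
From HB Require Import structures.
From mathcomp Require Import all_boot all_order all_algebra.
From mathcomp Require Import all_classical all_reals all_analysis.

Set Implicit Arguments.
Unset Strict Implicit.
Unset Printing Implicit Defensive.

Import Order.TTheory GRing.Theory Num.Theory.
Import numFieldNormedType.Exports.

Local Open Scope classical_set_scope.
Local Open Scope ring_scope.

Section Distribution.
Context (A : choiceType) (R : realType).
Implicit Types (p : A -> R) (n r : nat) (eps : R).

Definition is_prob_distr p : Prop :=
  (forall a, 0 <= p a <= 1) /\ (\esum_(a in [set: A]) (p a)%:E)%E = 1%E.

(* [counting] is the cardinality of a finite set and +oo otherwise. *)
Definition nu p eps : \bar R := counting [set a | eps <= p a].

Definition cst_c r : R :=
  if r == 0%N then expR (-1)
  else expR 1 * (1 + r)%:R / Num.sqrt pi.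

Definition phi_plus p n r eps : \bar R :=
  ((cst_c r)%:E * nu p eps * (n%:R^-1)%:E)%E.

Definition psi_plus p n r eps : \bar R :=
  (((2 ^ (1 + r) * 'C(n, r))%:R)%:E *
   \int[lebesgue_measure]_(u in `[0%R, eps])
     (nu p (u / 2) * (u ^+ r * (1 - u / 2) ^+ (n - r))%:E))%E.

Definition is_max (S : set R) (m : R) : Prop := S m /\ ubound S m.

End Distribution.

Section Sample.
Context d dA (T : measurableType d) (A : measurableType dA) (R : realType).
Variable P : probability T R.

Definition mutually_independent (I : finType) (X : I -> {RV P >-> A}) : Prop :=
  forall (J : {set I}) (B : I -> set A), (forall i, measurable (B i)) ->
    P (\bigcap_(i in [set` J]) (X i @^-1` B i)) =
    (\prod_(i in J) P (X i @^-1` B i))%E.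

Definition iid_sample n (p : A -> R) (X : 'I_n -> {RV P >-> A}) : Prop :=
  mutually_independent X /\
  forall i a, distribution P (X i) [set a] = (p a)%:E.

Definition xi n (X : 'I_n -> {RV P >-> A}) (a : A) (w : T) : nat :=
  (\sum_(i < n) (X i w == a))%N.

(* The sum is finite for a probability distribution [p], so that [fine] loses
   nothing: see [occupancyE]. *)
Definition occupancy n (p : A -> R) (X : 'I_n -> {RV P >-> A}) (r : nat)
    (w : T) : R :=
  fine (\esum_(a in [set: A]) (p a * (xi X a w == r)%:R)%:E)%E.

Lemma occupancyE n (p : A -> R) (X : 'I_n -> {RV P >-> A}) (r : nat) (w : T) :
  is_prob_distr p ->
  (occupancy p X r w)%:E =
  (\esum_(a in [set: A]) (p a * (xi X a w == r)%:R)%:E)%E.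
Proof.
move=> [p01 p1]; have p0 a : 0 <= p a by case/andP: (p01 a).
rewrite fineK// ge0_fin_numE; last first.
  by apply: esum_ge0 => a _; rewrite lee_fin mulr_ge0.
apply: (@le_lt_trans _ _ 1%E); last exact: ltry.
rewrite -p1; apply: le_esum => a _; rewrite lee_fin.
by case: (_ == _); rewrite ?mulr1// mulr0.
Qed.

End Sample.

(* Main.v *)
Require Import Defs.
From HB Require Import structures.
From mathcomp Require Import all_boot all_order all_algebra.
From mathcomp Require Import finmap.
From mathcomp Require Import all_classical all_reals all_analysis.
From mathcomp Require Import measurable_realfun.
From mathcomp Require Import lra ring.

Set Implicit Arguments.
Unset Strict Implicit.
Unset Printing Implicit Defensive.

Import Order.TTheory GRing.Theory Num.Theory.
Import numFieldNormedType.Exports.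

Local Open Scope classical_set_scope.
Local Open Scope ring_scope.
Local Open Scope ereal_scope.

(** Since the X_i are independent with law p, the count of each symbol a is
    binomial, so exchanging expectation and the countable sum over a gives
<<
      E M_{n,r} = \sum_a p_a 'C(n, r) p_a^r (1 - p_a)^(n-r)
>>
    ([expectation_occupancy]).  Cut this sum at the level eps.

    The atoms with p_a >= eps are nu(eps) in number, and each term is at most
    c(r) / n.  For r = 0 this is t e^{-t} <= e^{-1} at t = n p_a.  For r >= 1 it
    is crude: the term equals (r+1)/(n+1) times the binomial probability of
    r+1 successes in n+1 trials, hence is at most (r+1)/n, and e >= sqrt pi
    ([occupancy_term_le]).

    An atom x = p_a < eps is charged to the interval [x/2, x], which lies in
    [0, eps].  For u in it, u^r (1 - u/2)^(n-r) >= (x/2)^r (1 - x)^(n-r), so the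
    integral of the left side over that interval of length x/2 is at least
    2^{-1-r} x^{r+1} (1 - x)^(n-r).  At a given u only atoms with
    p_a >= u >= u/2 are charged, at most nu(u/2) of them; summing over the atoms
    under the integral sign yields psi ([esum_small_atoms_le]).

    For r = n the term is p_a^{n+1}: at most p_star^{n+1} for the large atoms,
    at most eps^n p_a for the small ones, and the p_a sum to 1.  The maximum
    p_star exists because only finitely many atoms exceed a positive level. *)

(** * One term of the expected occupancy *)

Section RealBounds.
Local Open Scope ring_scope.
Context (R : realType).
Implicit Types (x : R) (n r : nat).

(** It is one summand of (x + (1 - x))^n = 1. *)
Lemma binomial_term_le1 n r x : 0 <= x <= 1 ->
  'C(n, r)%:R * x ^+ r * (1 - x) ^+ (n - r) <= 1.
Proof.
move=> /andP[x0 x1]; have [nr|rn] := ltnP n r.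
  by rewrite bin_small// !mul0r.
have y0 : 0 <= 1 - x by rewrite subr_ge0.
have E : 1 = \sum_(i < n.+1) (1 - x) ^+ (n - i) * x ^+ i *+ 'C(n, i).
  by rewrite -exprDn subrK expr1n.
rewrite [leRHS]E (bigD1 (Ordinal (rn : (r < n.+1)%N)))//= -mulrA mulr_natl.
rewrite -[leLHS]addr0 mulrC lerD// sumr_ge0// => i _.
by rewrite mulrn_wge0// mulr_ge0// exprn_ge0.
Qed.

Lemma mul_expR_le x : x * expR (- x) <= expR (-1).
Proof.
have : x <= expR (x - 1) by have := expR_ge1Dx (x - 1); lra.
move=> /(ler_wpM2r (expR_ge0 (- x))) /le_trans; apply.
by rewrite -expRD; have -> : x - 1 + - x = -1 by lra.
Qed.

(** The factor e / sqrt pi in c(r) is at least 1, because pi < 4 and e >= 2. *)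
Lemma succ_le_cst_c r : (0 < r)%N -> r.+1%:R <= cst_c R r.
Proof.
case: r => // r _; rewrite /cst_c/= add1n.
have sp : 0 < Num.sqrt (pi : R) by rewrite sqrtr_gt0 pi_gt0.
rewrite ler_pdivlMr// mulrC ler_wpM2r//.
apply: (@le_trans _ _ 2); last by have := expR_ge1Dx (1 : R); lra.
have -> : (2 : R) = Num.sqrt (2 ^+ 2) by rewrite sqrtr_sqr ger0_norm.
by apply: ler_wsqrtr; have := @pihalf_lt2 R; lra.
Qed.

(** For r >= 1, (r+1) 'C(n+1, r+1) = (n+1) 'C(n, r) turns the extra factor x
    into one more success: the term becomes (r+1)/(n+1) times a binomial
    probability for n+1 trials.  For r = 0, (1 - x)^n <= e^{-nx}. *)
Lemma occupancy_term_le n r x : (0 < n)%N -> 0 <= x <= 1 ->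
  x * ('C(n, r)%:R * x ^+ r * (1 - x) ^+ (n - r)) <= cst_c R r / n%:R.
Proof.
move=> n0 x01; have /andP[x0 x1] := x01.
have n0' : 0 < n%:R :> R by rewrite ltr0n.
have y0 : 0 <= 1 - x by rewrite subr_ge0.
rewrite ler_pdivlMr//; have [->|r0] := posnP r.
  rewrite /cst_c eqxx bin0 subn0 expr0 !mul1r.
  apply: le_trans (mul_expR_le (n%:R * x)).
  have : (1 - x) ^+ n <= expR (- x) ^+ n.
    by apply: lerXn2r; rewrite ?nnegrE ?expR_ge0//; exact: expR_ge1Dx.
  rewrite -expRM_natl mulrN => h.
  rewrite mulrAC (mulrC x n%:R) ler_wpM2l// mulr_ge0//.
apply: le_trans (succ_le_cst_c r0).
have -> : x * ('C(n, r)%:R * x ^+ r * (1 - x) ^+ (n - r)) * n%:R =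
  r.+1%:R * ('C(n.+1, r.+1)%:R * x ^+ r.+1 * (1 - x) ^+ (n.+1 - r.+1)) *
  (n%:R / n.+1%:R).
  have := congr1 (fun k => k%:R : R) (mul_bin_diag n.+1 r).
  rewrite !natrM subSS exprS => E; rewrite (mulrC _ (n%:R / _)) !mulrA.
  rewrite -(mulrA _ r.+1%:R) -E.
  by field; rewrite addrC natr1 pnatr_eq0.
rewrite -[leRHS]mulr1 -[X in _ <= X]mulr1 ler_pM//.
- by rewrite !mulr_ge0// exprn_ge0.
- by rewrite ler_wpM2l// binomial_term_le1.
- by rewrite ler_pdivrMr// mul1r ler_nat.
Qed.

End RealBounds.

(** * Counting the atoms above a level *)

Section Counting.
Context (A : choiceType) (R : realType).
Implicit Types (p : A -> R) (S : set A) (c eps : R).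

Lemma esum_cst_finite S c : finite_set S -> (0 <= c)%R ->
  \esum_(a in S) c%:E = c%:E * counting S.
Proof.
move=> finS c0; rewrite esum_fset ?fsbig_finite//= /counting asboolT//.
rewrite big_const_seq count_predT -EFinM; elim: (size _) => [|k IH]/=.
  by rewrite mulr0.
by rewrite IH -EFinD -[k.+1%:R]natr1; congr EFin; ring.
Qed.

(** If [S] is infinite the right-hand side is +oo, except that it vanishes
    for [c = 0], where the left-hand side vanishes too. *)
Lemma esum_cst_le S c : (0 <= c)%R ->
  \esum_(a in S) c%:E <= c%:E * counting S.
Proof.
move=> c0; have [finS|infS] := pselect (finite_set S).
  by rewrite esum_cst_finite.
rewrite /counting asboolF//; move: c0; rewrite le_eqVlt => /predU1P[<-|c0].
  by rewrite mul0e esum1.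
by rewrite mulry gtr0_sg// mul1e leey.
Qed.

(** More than 1/eps atoms of mass at least eps would have total mass above 1. *)
Lemma finite_atoms_ge p eps : is_prob_distr p -> (0 < eps)%R ->
  finite_set [set a | eps <= p a]%R.
Proof.
move=> [p01 p1] eps0; apply: contrapT => /(@infinite_set_fset _ _ (Num.truncn eps^-1).+1).
move=> [B Bp sB].
have : \esum_(a in [set` B]) eps%:E <= 1.
  rewrite -p1; apply: (@le_trans _ _ (\esum_(a in [set` B]) (p a)%:E)).
    by apply: le_esum => a /Bp; rewrite lee_fin.
  rewrite esum_mkcond; apply: le_esum => a _.
  by case: ifP => // _; rewrite lee_fin; case/andP: (p01 a).
rewrite esum_cst_finite ?(ltW eps0)// /counting asboolT// set_fsetK lee_fin.
rewrite -ler_pdivlMl// mulr1 leNgt => /negP; apply.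
apply: lt_le_trans (truncnS_gt _) _.
by rewrite ler_nat.
Qed.

Lemma nu_nonincreasing p : {homo nu p : x y / (y <= x)%R >-> x <= y}.
Proof.
move=> x y yx; rewrite /nu -[leLHS]mul1e.
have [finy|infy] := pselect (finite_set [set a | y <= p a]%R); last first.
  by rewrite [leRHS]/counting asboolF// leey.
have sub : [set a | x <= p a]%R `<=` [set a | y <= p a]%R.
  by move=> a /=; exact: le_trans.
rewrite -[leRHS]mul1e -!esum_cst_finite//; last exact: sub_finite_set finy.
rewrite esum_mkcond [leRHS]esum_mkcond; apply: le_esum => a _.
by case: ifPn => [/[!inE]/sub ha|_]; [rewrite mem_set|case: ifP].
Qed.

(** A monotone function has intervals as its superlevel sets. *)
Lemma measurable_nu p (D : set R) : measurable D -> measurable_fun D (nu p).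
Proof.
move=> mD; apply: (measurability _ (ErealGenCInfty.measurableE R)) => //.
move=> /= _ [_ [r ->]] <-; apply: measurableI => //.
apply: is_interval_measurable => s t /=.
rewrite !in_itv/= !andbT => fs ft u /andP[su ut].
by rewrite in_itv/= andbT (le_trans ft)// nu_nonincreasing.
Qed.

(** Some atom [a0] has positive mass, and the finitely many atoms at least as
    heavy as [a0] contain a heaviest one. *)
Lemma exists_max_atom p : is_prob_distr p -> exists m, is_max (range p) m /\ (0 < m <= 1)%R.
Proof.
move=> pd; have [p01 p1] := pd.
have [a0 pa0] : exists a, (0 < p a)%R.
  apply: contrapT => /forallNP np; move: p1; rewrite esum1 => [/eqP|a _].
    by rewrite eqe eq_sym oner_eq0.
  by apply/eqP; rewrite eqe eq_le leNgt; case/andP: (p01 a) => -> _; rewrite (introN idP (np a)).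
have [B EB] := finite_fsetP.1 (finite_atoms_ge pd pa0).
have a0B : a0 \in B by have : [set` B] a0 by rewrite -EB/=.
case: (@Order.TotalTheory.arg_maxP _ _ _ [` a0B]%fset xpredT (p \o val)) => // b _ bmax.
exists (p (val b)); split; first split; first by exists (val b).
  move=> _ [a _ <-]; have [aB|] := leP (p a0) (p a).
    have {}aB : a \in B by have : [set` B] a by rewrite -EB/=.
    exact: bmax [` aB]%fset isT.
  by move=> /ltW/le_trans; apply; exact: bmax [` a0B]%fset isT.
apply/andP; split; last by case/andP: (p01 (val b)).
exact/(lt_le_trans pa0)/(bmax [` a0B]%fset isT).
Qed.

End Counting.

Lemma esumZl_le (R : realType) (A : choiceType) (S : set A) (c : R) (f : A -> \bar R) :
  (0 <= c)%R -> (forall a, 0 <= f a) ->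
  \esum_(a in S) (c%:E * f a) <= c%:E * \esum_(a in S) f a.
Proof.
move=> c0 f0; apply: ge_ereal_sup => _ [F FS <-].
rewrite -ge0_mule_fsumr//; apply: lee_wpmul2l; first by rewrite lee_fin.
by apply: ereal_sup_ubound; exists F.
Qed.

(** The cut at level [eps]: a uniform bound on the terms handles the atoms of
    mass at least [eps], of which there are nu(eps). *)
Lemma esum_le_atoms_split (R : realType) (A : choiceType) (p : A -> R) (f : A -> R)
    (c eps : R) (y : \bar R) :
  (0 <= c)%R -> (forall a, 0 <= f a)%R -> (forall a, f a <= c)%R ->
  \esum_(a in [set a | p a < eps]%R) (f a)%:E <= y ->
  \esum_(a in [set: A]) (f a)%:E <= c%:E * nu p eps + y.
Proof.
move=> c0 f0 fc fy; rewrite (esumID [set a | eps <= p a]%R); last first.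
  by move=> a _; rewrite lee_fin.
rewrite !setTI; apply: leeD.
  apply: le_trans (esum_cst_le _ c0); apply: le_esum => a _.
  by rewrite lee_fin.
have -> // : ~` [set a | eps <= p a]%R = [set a | p a < eps]%R.
by apply/seteqP; split => a /=; rewrite ltNge => /negP.
Qed.

(** * Atoms below the level *)

Section SmallAtoms.
Context (A : choiceType) (R : realType).
Implicit Types (p : A -> R) (n r : nat) (eps : R).

(** Evaluates the charge [K] that an atom of mass [x] spreads over [x/2, x];
    [x < eps] is what keeps this interval within the domain of integration. *)
Lemma integral_half_itv eps x (K : R) : (0 <= K)%R -> (0 <= x < eps)%R ->
  \int[lebesgue_measure]_(u in `[0%R, eps]) (K * \1_(`[(x / 2)%R, x]) u)%:E =
  (x / 2 * K)%:E.
Proof.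
move=> K0 /andP[x0 xe].
under eq_integral do rewrite EFinM.
rewrite ge0_integralZl_EFin//; last first.
  by apply/measurable_EFinP; exact: measurable_indic.
rewrite integral_indic//= setIidl; last first.
  move=> u /=; rewrite !in_itv/= => /andP[xu ux]; apply/andP; split; lra.
rewrite lebesgue_measure_itv/= lte_fin; case: ltP => h.
  by rewrite -EFinB -EFinM; congr EFin; lra.
have -> : x = 0%R by lra.
by rewrite mule0 mul0r mul0r.
Qed.

(** Atom [a] is charged the constant (p_a / 2)^r (1 - p_a)^(n-r) on
    [p_a / 2, p_a]; the factor 2^(1+r) restores p_a^(r+1) from the length p_a / 2
    of the interval and the power (p_a / 2)^r.  At a point u the charges add up
    to at most the integrand of [psi_plus], as the atoms charged there satisfy
    u / 2 <= p_a.  Working with finite sets of atoms, whose supremum is the sum,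
    leaves only a finite sum to move through the integral. *)
Lemma esum_small_atoms_le p n r eps : (forall a, 0 <= p a)%R -> (eps <= 1)%R ->
  \esum_(a in [set a | p a < eps]%R)
    (p a * ('C(n, r)%:R * p a ^+ r * (1 - p a) ^+ (n - r)))%:E <=
  psi_plus p n r eps.
Proof.
move=> p0 eps1; apply: ge_ereal_sup => _ [F [finF Feps] <-].
rewrite /psi_plus.
pose g u : R := (u ^+ r * (1 - u / 2) ^+ (n - r))%R.
pose K a : R := ((p a / 2) ^+ r * (1 - p a) ^+ (n - r))%R.
have K0 a : F a -> (0 <= K a)%R.
  move=> /Feps/= pa; rewrite mulr_ge0// exprn_ge0//; last by lra.
  by rewrite divr_ge0.
(* [K a] can be negative when 1 < p a, which [F] excludes; truncating at 0
   makes [I a] nonnegative for every [a], as integrating the sum demands. *)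
pose I a u := (Num.max 0 (K a) * \1_(`[(p a / 2)%R, p a]) u)%:E.
have I0 a u : 0 <= I a u by rewrite lee_fin mulr_ge0// le_max lexx.
have mI a : measurable_fun [set` `[0%R, eps]] (I a).
  rewrite /I; apply/measurable_EFinP; apply: measurable_funM => //;
    exact: measurable_indic.
have g0 u : (u \in `[0, eps])%R -> (0 <= g u)%R.
  by rewrite in_itv/= => /andP[u0 ue]; rewrite mulr_ge0// exprn_ge0//; lra.
have mnu : measurable_fun [set` `[0%R, eps]] (fun u => nu p (u / 2)).
  apply: (@measurableT_comp _ _ _ _ _ _ (nu p)); first exact: measurable_nu.
  exact: measurable_funM.
apply: (@le_trans _ _ (((2 ^ (1 + r) * 'C(n, r))%:R)%:E *
    \int[lebesgue_measure]_(u in `[0%R, eps]) \sum_(a <- fset_set F) I a u)).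
  rewrite ge0_integral_sum// ge0_sume_distrr; last first.
    by move=> a _; apply: integral_ge0.
  rewrite fsbig_finite//= big_seq [leRHS]big_seq; apply: lee_sum => a.
  rewrite in_fset_set// inE => aF; have pa := Feps _ aF.
  rewrite /I integral_half_itv ?max_r ?K0 ?p0//.
  rewrite -EFinM lee_fin natrM natrX exprD expr1 /K expr_div_n.
  rewrite le_eqVlt; apply/orP; left; apply/eqP; field.
  by rewrite expf_neq0.
apply: lee_wpmul2l; first by rewrite lee_fin.
apply: ge0_le_integral => //.
- by move=> u _; exact: sume_ge0.
- exact: emeasurable_sum.
- apply: emeasurable_funM => //; apply/measurable_EFinP.
  apply: measurable_funM; first exact: measurable_funX.
  apply: measurable_funX; apply: measurable_funB => //.
  exact: measurable_funM.
move=> u /= ue; rewrite -/(g u) muleC.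
apply: le_trans (esum_cst_le _ (g0 _ ue)).
rewrite esum_mkcond.
apply: (@le_trans _ _ (\sum_(a \in F)
    if a \in [set a | u / 2 <= p a]%R then (g u)%:E else 0)); last first.
  by apply: ereal_sup_ubound; exists F.
rewrite fsbig_finite//= big_seq [leRHS]big_seq; apply: lee_sum => a.
rewrite in_fset_set// inE => aF; have := Feps _ aF => /= pa.
rewrite /I max_r ?K0// indicE.
have [/set_mem/=|_] := boolP (u \in _); last first.
  by rewrite mulr0; case: ifP => //; rewrite lee_fin g0.
move: ue; rewrite !in_itv/= => /andP[u0 ue] /andP[pu up].
rewrite mem_set/=; last by lra.
rewrite mulr1 lee_fin ler_pM// ?exprn_ge0//; [| |apply: lerXn2r|apply: lerXn2r];
  rewrite ?nnegrE ?divr_ge0//; lra.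
Qed.

End SmallAtoms.

(** * The expected occupancy *)

Section CountableExchange.
Context d (T : measurableType d) (R : realType) (mu : {measure set T -> \bar R}).
Context (A : choiceType).

(** Presents a sum over a countable type as a series, [inv] being the partial
    inverse of an enumeration [e], so that results on series apply. *)
Lemma esum_countable_nneseries (inv : nat -> option A) (e : A -> nat)
    (g : A -> \bar R) : pcancel e inv -> (forall k a, inv k = Some a -> e a = k) ->
  (forall a, 0 <= g a) ->
  \esum_(a in [set: A]) g a = \sum_(k <oo) oapp g 0 (inv k).
Proof.
move=> eK invK g0; rewrite nneseries_esumT; last by move=> k; case: (inv k) => /=.
have -> : \esum_(a in [set: A]) g a = \esum_(a in [set: A]) oapp g 0 (inv (e a)).
  by apply: eq_esum => a _; rewrite eK.
rewrite -(esum_image setT e (fun k => oapp g 0 (inv k))); last first.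
  by apply: in2W; exact: pcan_inj eK.
rewrite esum_mkcond; apply: eq_esum => k _.
case: ifPn => // /negP; case ik: (inv k) => [a|]// [].
by rewrite inE; exists a => //; exact: invK.
Qed.

Lemma integral_esum (f : A -> T -> \bar R) : countable [set: A] ->
  (forall a, measurable_fun setT (f a)) -> (forall a x, 0 <= f a x) ->
  (\int[mu]_x \esum_(a in [set: A]) f a x) =
  \esum_(a in [set: A]) (\int[mu]_x f a x).
Proof.
move=> /countable_injP[e e_inj] mf f0.
(* [e] need not be onto, so the inverse is partial. *)
pose inv k := if pselect (exists a, e a = k) is left h then Some (projT1 (cid h))
              else None.
have invK k a : inv k = Some a -> e a = k.
  by rewrite /inv; case: pselect => // h [<-]; case: cid.
have eK : pcancel e inv.
  move=> a; rewrite /inv; case: pselect => [h|]; last by case; exists a.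
  by congr Some; apply: e_inj; rewrite ?inE//; case: cid.
under eq_integral do rewrite (esum_countable_nneseries eK invK)//.
rewrite integral_nneseries//; last 2 first.
- by move=> k; case: (inv k).
- by move=> k x _; case: (inv k) => /=.
rewrite (esum_countable_nneseries eK invK) => [|a]; last exact: integral_ge0.
by apply: eq_eseriesr => k _; case: (inv k) => //=; rewrite integral0.
Qed.

End CountableExchange.

Section BinomialLaw.
Context d dA (T : measurableType d) (A : measurableType dA) (R : realType).
Context (P : probability T R).

Definition hit_event n (X : 'I_n -> {RV P >-> A}) (a : A) (J : {set 'I_n}) :=
  [set w | forall i, (X i w == a) = (i \in J)].

Lemma measurable_hit_event n (X : 'I_n -> {RV P >-> A}) a J :
  (forall B : set A, measurable B) -> measurable (hit_event X a J).
Proof.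
move=> mA; have -> : hit_event X a J = \bigcap_(i in [set: 'I_n])
    X i @^-1` [set b | (b == a) = (i \in J)].
  by apply/seteqP; split => w /= h i; [move=> _|]; exact: h.
apply: fin_bigcap_measurable => // i _.
by rewrite -[X in measurable X]setTI; apply: (measurable_funPT (X i)).
Qed.

Lemma xi_eq_bigcup n (X : 'I_n -> {RV P >-> A}) a r :
  [set w | xi X a w = r] =
  \bigcup_(J in [set` [set J : {set 'I_n} | #|J| == r]%SET]) hit_event X a J.
Proof.
apply/seteqP; split => w.
  move=> wr; exists [set i | X i w == a]%SET; last by move=> i; rewrite inE.
  rewrite /= inE -wr /xi -sum1_card big_mkcond/=; apply/eqP/eq_bigr => i _.
  by rewrite inE; case: eqP.
move=> [J/=]; rewrite inE => /eqP <- wE.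
rewrite /xi -sum1_card [RHS]big_mkcond/=; apply: eq_bigr => i _.
by rewrite wE; case: (_ \in _).
Qed.

Lemma measurable_xi n (X : 'I_n -> {RV P >-> A}) a r :
  (forall B : set A, measurable B) -> measurable [set w | xi X a w = r].
Proof.
move=> mA; rewrite xi_eq_bigcup; apply: fin_bigcup_measurable => // J _.
exact: measurable_hit_event.
Qed.

(** Independence over the full index set, so that the misses (X_i <> a for i
    outside J) contribute their factors 1 - p_a along with the hits. *)
Lemma prob_hit_event n (p : A -> R) (X : 'I_n -> {RV P >-> A}) (a : A)
    (J : {set 'I_n}) :
  (forall B : set A, measurable B) -> iid_sample p X ->
  P (hit_event X a J) =
  (p a ^+ #|J| * (1 - p a) ^+ (n - #|J|))%:E.
Proof.
move=> mA [indep law].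
pose B i : set A := if i \in J then [set a] else ~` [set a].
have PB i : P (X i @^-1` B i) = (if i \in J then p a else 1 - p a)%:E.
  have Pa : P (X i @^-1` [set a]) = (p a)%:E by have := law i a.
  rewrite /B; case: ifP => _ //.
  rewrite -preimage_setC probability_setC ?Pa//.
  by rewrite -[X in measurable X]setTI; apply: (measurable_funPT (X i)).
have := indep [set: 'I_n]%SET B (fun=> mA _).
under eq_bigr do rewrite PB.
rewrite prodEFin (bigID (mem J))/=.
rewrite (eq_bigr (fun=> p a)) => [|i /andP[_ ->]//].
rewrite [X in (_ * X)%R](eq_bigr (fun=> 1 - p a)%R) => [|i /andP[_ /negbTE ->]//].
rewrite !prodr_const => H.
have -> : hit_event X a J =
    \bigcap_(i in [set` [set: 'I_n]%SET]) X i @^-1` B i.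
  apply/seteqP; split => w /= h i.
    move=> _; rewrite /B /preimage/= -h.
    by case: eqP.
  have : B i (X i w) by apply: h => /=; rewrite finset.in_setT.
  by rewrite /B; case: (i \in J) => /= [->|/eqP/negbTE//]; rewrite eqxx.
rewrite H; have -> : (n - #|J|)%N = #|~: J|%SET.
  by rewrite [RHS]cardsCs finset.setCK card_ord.
congr (_ ^+ _ * _ ^+ _)%R%:E; apply: eq_card => i.
  by rewrite [LHS]unfold_in finset.in_setT.
by rewrite [LHS]unfold_in finset.in_setT finset.in_setC.
Qed.

(** The binomial law of the counts: the 'C(n, r) hit patterns of size r are
    disjoint and equally likely. *)
Lemma prob_xi n (p : A -> R) (X : 'I_n -> {RV P >-> A}) (a : A) r :
  (forall B : set A, measurable B) -> iid_sample p X ->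
  P [set w | xi X a w = r] =
  ('C(n, r)%:R * p a ^+ r * (1 - p a) ^+ (n - r))%:E.
Proof.
move=> mA iid.
rewrite xi_eq_bigcup measure_fin_bigcup//; last 2 first.
- by move=> J1 J2 _ _ [w [w1 w2]]; apply/setP => i; rewrite -w1 w2.
- by move=> J _; exact: measurable_hit_event.
rewrite (fsbigE (enum [set J : {set 'I_n} | #|J| == r]%SET)) ?enum_uniq//=; last 2 first.
- by move=> J/=; rewrite mem_enum.
- by move=> J/= JE; rewrite mem_enum JE.
rewrite big_enum_cond/=.
rewrite (eq_bigr (fun=> (p a ^+ r * (1 - p a) ^+ (n - r))%:E)); last first.
  move=> J /andP[]; rewrite finset.in_set => /eqP Jr _.
  by have := prob_hit_event a J mA iid; rewrite Jr.
rewrite (eq_bigl (fun J => J \in [set J : {set 'I_n} | #|J| == r]%SET)); last first.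
  by move=> J; rewrite mem_setE andbb.
by rewrite sumEFin sumr_const card_draws card_ord -mulrA mulr_natl.
Qed.

Lemma expectation_occupancy n (p : A -> R) (X : 'I_n -> {RV P >-> A}) r :
  countable [set: A] -> (forall B : set A, measurable B) -> is_prob_distr p ->
  iid_sample p X ->
  'E_P[occupancy p X r] =
  \esum_(a in [set: A])
    (p a * ('C(n, r)%:R * p a ^+ r * (1 - p a) ^+ (n - r)))%:E.
Proof.
move=> cA mA pd iid; have p0 a : (0 <= p a)%R by case/andP: (pd.1 a).
have mxi a : measurable [set w | xi X a w = r].
  exact: measurable_xi.
rewrite unlock; under eq_integral do rewrite occupancyE//.
have xiE a w : ((xi X a w == r)%:R : R) = \1_[set w | xi X a w = r] w.
  by rewrite indicE; congr (nat_of_bool _)%:R;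
    apply/idP/idP => [/eqP h|/set_mem/= ->//]; exact: mem_set.
rewrite integral_esum//.
- apply: eq_esum => a _; under eq_integral do rewrite xiE EFinM.
  rewrite ge0_integralZl_EFin//.
    by rewrite integral_indic// setIT EFinM; congr (_ * _); exact: prob_xi.
  by apply/measurable_EFinP; exact: measurable_indic.
- move=> a; apply/measurable_EFinP; apply: measurable_funM => //.
  under eq_fun do rewrite xiE.
  exact: measurable_indic.
- by move=> a w; rewrite lee_fin mulr_ge0.
Qed.
End BinomialLaw.

(** * The bounds *)

Theorem theorem2p1 (R : realType)
    (d : measure_display) (T : measurableType d) (P : probability T R)
    (dA : measure_display) (A : measurableType dA)
    (A_countable : countable [set: A])
    (A_discrete : forall B : set A, measurable B)
    (p : A -> R) (p_distr : is_prob_distr p)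
    (n : nat) (n_ge1 : (1 <= n)%N)
    (X : 'I_n -> {RV P >-> A}) (X_iid : iid_sample p X) :
  (forall r : nat, (r <= n - 1)%N ->
    'E_P[occupancy p X r] <=
    ereal_inf [set phi_plus p n r eps + psi_plus p n r eps
              | eps in `[0%R, 1%R]%classic]) /\
  (exists p_star : R,
    [/\ is_max (range p) p_star,
        (0 < p_star <= 1)%R &
        'E_P[occupancy p X n] <=
        ereal_inf [set (p_star ^+ n.+1)%:E * nu p eps + (eps ^+ n)%:E
                  | eps in `[0%R, 1%R]%classic]]).
Proof.
have p01 := p_distr.1; have p0 a : (0 <= p a)%R by case/andP: (p01 a).
have term_ge0 r a : (0 <= p a * ('C(n, r)%:R * p a ^+ r * (1 - p a) ^+ (n - r)))%R.
  by rewrite !mulr_ge0 ?exprn_ge0// subr_ge0; case/andP: (p01 a).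
split=> [r _|].
  apply/ereal_infP => _ [eps /= + <-]; rewrite in_itv/= => /andP[_ eps1].
  rewrite expectation_occupancy// /phi_plus muleAC -EFinM.
  apply: esum_le_atoms_split => // [|a|]; last exact: esum_small_atoms_le.
    apply: divr_ge0 => //; rewrite /cst_c; case: ifP => _; first exact: expR_ge0.
    by apply: divr_ge0; rewrite ?sqrtr_ge0// mulr_ge0 ?expR_ge0.
  exact: occupancy_term_le.
have [m [[mp pm] m01]] := exists_max_atom p_distr; exists m; split => //.
apply/ereal_infP => _ [eps /= + <-]; rewrite in_itv/= => /andP[eps0 _].
have m0 : (0 <= m)%R by case/andP: m01 => /ltW.
have termE a : (p a * ('C(n, n)%:R * p a ^+ n * (1 - p a) ^+ (n - n)) =
    p a ^+ n.+1)%R.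
  by rewrite binn subnn mul1r mulr1 exprS.
rewrite expectation_occupancy//; apply: esum_le_atoms_split => //.
- exact: exprn_ge0.
- by move=> a; rewrite termE lerXn2r ?nnegrE//; apply: pm; exists a.
rewrite -[leRHS]mule1 -p_distr.2.
apply: (@le_trans _ _
    (\esum_(a in [set a | p a < eps]%R) ((eps ^+ n)%:E * (p a)%:E))).
  apply: le_esum => a /= pa; rewrite termE -EFinM lee_fin exprSr.
  by rewrite ler_wpM2r// lerXn2r ?nnegrE// ltW.
apply: le_trans (esumZl_le _ _ _) _; rewrite ?exprn_ge0//.
apply: lee_wpmul2l; first by rewrite lee_fin exprn_ge0.
rewrite esum_mkcond; apply: le_esum => a _.
by case: ifP => // _; rewrite lee_fin.
Qed.
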